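(* For every invertible linear operator $\mathcal R$ on $\mathbb S^k$ and every $Y\in\mathbb S^k$, the minimiser $B^*(\mathcal R,Y)$ of $B\mapsto\|\mathcal RB-Y\|_F^2$ over $B\succeq0$ is unique, and it is continuous in $(\mathcal R,Y)$. The maps $V$ and $T$, $$V(\mathcal R,Y)=\tfrac12\min_{B\succeq0}\|\mathcal RB-Y\|_F^2,\qquad T(\mathcal R,Y)=\|Y\|_F^2-2V(\mathcal R,Y),$$ are continuously Fréchet differentiable with respect to $\mathcal R$, and, with $B^*=B^*(\mathcal R,Y)$, $$\mathrm dT(\mathcal R,Y)[\dot{\mathcal R}]=-2\langle\mathcal RB^*-Y,\dot{\mathcal R}B^*\rangle.$$
   Context: $\mathbb S^k$ is the space of real symmetric $k\times k$ matrices with Frobenius inner product $\langle A,B\rangle=\operatorname{tr}(AB)$ and norm $\|\cdot\|_F$; $B\succeq0$ means $B$ is positive semidefinite. $\mathrm dT(\mathcal R,Y)[\dot{\mathcal R}]$ denotes the Fréchet derivative with respect to the operator $\mathcal R$ (in the finite-dimensional space of linear operators on $\mathbb S^k$) in the direction $\dot{\mathcal R}$. *)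

(* Defs.v *)
From HB Require Import structures.
From mathcomp Require Import all_boot all_order all_algebra.
From mathcomp Require Import all_classical all_reals all_analysis.
From mathcomp Require Import ring.

Set Implicit Arguments.
Unset Strict Implicit.
Unset Printing Implicit Defensive.

Import Order.TTheory GRing.Theory Num.Theory.
Import numFieldNormedType.Exports.

Local Open Scope classical_set_scope.
Local Open Scope ring_scope.

Section SymmetricMatrices.
Variables (R : realType) (k : nat).

Definition symspace : {vspace 'M[R]_k} := fixedSpace (linfun trmx).

Lemma symspaceP (A : 'M[R]_k) : reflect (A^T = A) (A \in symspace).
Proof. by apply: (iffP fixedSpaceP); rewrite lfunE. Qed.

(* An alias of subvs_of symspace, so that the Frobenius norm is attached to
   symmetric matrices only and not to every subspace. *)
Definition symmx : Type := subvs_of symspace.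

HB.instance Definition _ := Vector.on symmx.
HB.instance Definition _ := SubChoice.on symmx.

Implicit Types A B C : symmx.

Lemma symmx_sym A : (vsval A)^T = vsval A.
Proof. exact/symspaceP/subvsP. Qed.

Definition inner A B : R := \tr (vsval A *m vsval B).

Lemma innerE A B : inner A B = \sum_i \sum_j vsval A i j * vsval B i j.
Proof.
apply: eq_bigr => i _; rewrite mxE; apply: eq_bigr => j _.
by rewrite -[in LHS](symmx_sym B) mxE.
Qed.

Lemma innerC A B : inner A B = inner B A.
Proof. exact: mxtrace_mulC. Qed.

Lemma innerDl A B C : inner (A + B) C = inner A C + inner B C.
Proof. by rewrite /inner linearD mulmxDl mxtraceD. Qed.

Lemma innerZl a A B : inner (a *: A) B = a * inner A B.
Proof. by rewrite /inner linearZ -scalemxAl mxtraceZ. Qed.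

Lemma inner_ge0 A : 0 <= inner A A.
Proof.
by rewrite innerE; do 2!apply: sumr_ge0 => ? _; rewrite -expr2 sqr_ge0.
Qed.

Lemma inner_entry A i j : vsval A i j ^+ 2 <= inner A A.
Proof.
rewrite innerE (bigD1 i) //= (bigD1 j) //= -expr2 -addrA lerDl addr_ge0 //.
  by apply: sumr_ge0 => ? _; rewrite -expr2 sqr_ge0.
by do 2!apply: sumr_ge0 => ? _; rewrite -expr2 sqr_ge0.
Qed.

Lemma inner_eq0 A : inner A A = 0 -> A = 0.
Proof.
move=> A0; apply/val_inj/matrixP => i j; rewrite /= mxE; apply/eqP.
by rewrite -sqrf_eq0 eq_le sqr_ge0 andbT -A0 inner_entry.
Qed.

Lemma inner_CauchySchwarz A B : inner A B ^+ 2 <= inner A A * inner B B.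
Proof.
have [/inner_eq0 ->|B0] := eqVneq (inner B B) 0.
  have z C : inner C 0 = 0 by rewrite /inner mulmx0 mxtrace0.
  by rewrite !z expr0n mulr0.
have Bgt0 : 0 < inner B B by rewrite lt_neqAle eq_sym B0 inner_ge0.
set a := inner A A; set b := inner B B; set c := inner A B.
have : 0 <= inner (b *: A + (- c) *: B) (b *: A + (- c) *: B).
  exact: inner_ge0.
rewrite !(innerDl, innerZl, innerC _ (_ + _)) (innerC B A).
rewrite -/a -/b -/c => h.
have {h} : 0 <= b * (a * b - c ^+ 2).
  apply: le_trans h _; rewrite le_eqVlt; apply/orP; left; apply/eqP; ring.
by rewrite pmulr_rge0 // subr_ge0.
Qed.

Definition frobenius A : R := Num.sqrt (inner A A).

Lemma frobeniusD A B : frobenius (A + B) <= frobenius A + frobenius B.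
Proof.
rewrite -(@ler_pXn2r _ 2) ?nnegrE ?addr_ge0 ?sqrtr_ge0 //.
rewrite sqrrD !sqr_sqrtr ?inner_ge0 //.
rewrite !(innerDl, innerC _ (_ + _)) (innerC B A).
rewrite addrA lerD2r -addrA lerD2l -mulr2n lerMn2r /=.
apply: le_trans (ler_norm _) _.
rewrite -sqrtr_sqr /frobenius -sqrtrM ?inner_ge0 //.
by rewrite ler_wsqrtr // inner_CauchySchwarz.
Qed.

Lemma frobeniusZ a A : frobenius (a *: A) = `|a| * frobenius A.
Proof.
rewrite /frobenius innerZl innerC innerZl mulrA -expr2.
by rewrite sqrtrM ?sqr_ge0 // sqrtr_sqr.
Qed.

Lemma frobenius_eq0 A : frobenius A = 0 -> A = 0.
Proof.
move=> /eqP; rewrite sqrtr_eq0 => h; apply: inner_eq0.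
by apply/eqP; rewrite eq_le h inner_ge0.
Qed.

HB.instance Definition _ :=
  Lmodule_isNormed.Build R symmx frobeniusD frobeniusZ frobenius_eq0.

Lemma symmx_normE A : `|A| = Num.sqrt (\tr (vsval A *m vsval A)).
Proof. by []. Qed.

Lemma entry_le_norm A i j : `|vsval A i j| <= `|A|.
Proof. by rewrite -sqrtr_sqr ler_wsqrtr // inner_entry. Qed.

End SymmetricMatrices.

Section SymmetricOperators.
Variables (R : realType) (k : nat).
Local Notation S := (symmx R k).

(* An alias of 'End(S), so that the operator norm is attached to it. *)
Definition symop : Type := 'End(S).

HB.instance Definition _ := Vector.on symop.

Implicit Types F G : symop.

Definition opnorm F : R := sup [set `|F A| | A in [set A | `|A| <= 1]].

Lemma symop_bounded F : exists M, forall A, `|F A| <= M * `|A|.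
Proof.
exists (\sum_i \sum_j `|F (vsproj (symspace R k) (delta_mx i j))|) => A.
rewrite -{1}(vsvalK A) {1}(matrix_sum_delta (vsval A)) !linear_sum.
rewrite mulr_suml; apply: le_trans (ler_norm_sum _ _ _) _.
apply: ler_sum => i _; rewrite !linear_sum mulr_suml.
apply: le_trans (ler_norm_sum _ _ _) _; apply: ler_sum => j _.
by rewrite !linearZ normrZ mulrC ler_wpM2l // entry_le_norm.
Qed.

Lemma opnorm_has_sup F : has_sup [set `|F A| | A in [set A | `|A| <= 1]].
Proof.
split; first by exists `|F 0|, 0 => //=; rewrite normr0.
have [M FM] := symop_bounded F; exists `|M| => _ [A /= A1 <-].
apply: le_trans (FM A) _; apply: le_trans (_ : `|M| * `|A| <= _).
  by rewrite ler_wpM2r // ler_norm.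
by rewrite ler_piMr.
Qed.

Lemma opnorm_ball F A : `|A| <= 1 -> `|F A| <= opnorm F.
Proof.
by move=> A1; apply: (sup_ubound (opnorm_has_sup F).2); exists A.
Qed.

Lemma opnorm_le F M : (forall A, `|A| <= 1 -> `|F A| <= M) -> opnorm F <= M.
Proof.
move=> FM; apply: ge_sup; first exact: (opnorm_has_sup F).1.
by move=> _ [A A1 <-]; exact: FM.
Qed.

Lemma opnorm_ge0 F : 0 <= opnorm F.
Proof. by apply: le_trans (@opnorm_ball F 0 _); rewrite ?normr0. Qed.

Lemma le_opnorm F A : `|F A| <= opnorm F * `|A|.
Proof.
have [->|A0] := eqVneq A 0; first by rewrite linear0 !normr0 mulr0.
have nA : 0 < `|A| by rewrite normr_gt0.
rewrite -ler_pdivrMr // mulrC -[X in X * _]ger0_norm ?invr_ge0 //.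
rewrite -normrZ -linearZ; apply: opnorm_ball.
by rewrite normrZ ger0_norm ?invr_ge0 // mulVf // gt_eqF.
Qed.

Lemma opnormD F G : opnorm (F + G) <= opnorm F + opnorm G.
Proof.
apply: opnorm_le => A A1; rewrite add_lfunE.
by apply: le_trans (ler_normD _ _) _; apply: lerD; exact: opnorm_ball.
Qed.

Lemma opnormZ_le (a : R) F : opnorm (a *: F) <= `|a| * opnorm F.
Proof.
apply: opnorm_le => A A1; rewrite scale_lfunE normrZ.
by rewrite ler_wpM2l //; exact: opnorm_ball.
Qed.

Lemma opnormZ (a : R) F : opnorm (a *: F) = `|a| * opnorm F.
Proof.
apply/eqP; rewrite eq_le opnormZ_le /=.
have [->|a0] := eqVneq a 0; first by rewrite normr0 mul0r opnorm_ge0.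
rewrite mulrC -ler_pdivlMr ?normr_gt0 // mulrC -normfV.
by rewrite -{1}[F](scalerK a0) opnormZ_le.
Qed.

Lemma opnorm_eq0 F : opnorm F = 0 -> F = 0.
Proof.
move=> F0; apply/lfunP => A; rewrite zero_lfunE; apply/eqP.
by rewrite -normr_le0 -[0](mul0r `|A|) -F0; exact: le_opnorm.
Qed.

HB.instance Definition _ :=
  Lmodule_isNormed.Build R symop opnormD opnormZ opnorm_eq0.

Lemma symop_normE F :
  `|F| = sup [set `|F A| | A in [set A | `|A| <= 1]].
Proof. by []. Qed.

End SymmetricOperators.

Section LeastSquares.
Variables (R : realType) (k : nat).
Local Notation S := (symmx R k).

Definition psd : set S :=
  [set B | forall x : 'cV[R]_k, 0 <= (x^T *m vsval B *m x) 0 0].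

Definition objective (F : symop R k) (Y B : S) : R := `|F B - Y| ^+ 2.

Definition minimiser (F : symop R k) (Y B : S) : Prop :=
  psd B /\ forall C, psd C -> objective F Y B <= objective F Y C.

(* [get] returns a default value where there is no minimiser. *)
Definition Bstar (F : symop R k) (Y : S) : S := get (minimiser F Y).

(* The infimum is the minimum wherever a minimiser exists. *)
Definition V (F : symop R k) (Y : S) : R :=
  2^-1 * inf [set objective F Y B | B in psd].

Definition T (F : symop R k) (Y : S) : R := `|Y| ^+ 2 - 2 * V F Y.

End LeastSquares.

(* The second clause is continuity of x |-> 'd f x on D for the operator norm
   on the continuous linear maps from U to W. *)
Definition continuously_differentiable_on (R : realType)
    (U W : normedModType R) (D : set U) (f : U -> W) : Prop :=
  (forall x, D x -> differentiable f x) /\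
  (forall x, D x -> forall e : R, 0 < e ->
     \forall y \near within D (nbhs x),
       forall h, `|'d f y h - 'd f x h| <= e * `|h|).

(* Main.v *)
Require Import Defs.
From HB Require Import structures.
From mathcomp Require Import all_boot all_order all_algebra.
From mathcomp Require Import all_classical all_reals all_analysis.
From mathcomp Require Import ring lra.

Set Implicit Arguments.
Unset Strict Implicit.
Unset Printing Implicit Defensive.

Import Order.TTheory GRing.Theory Num.Theory.
Import numFieldNormedType.Exports.

Local Open Scope classical_set_scope.
Local Open Scope ring_scope.

(** Everything rests on convexity, used quantitatively. An invertible [F] is
    bounded below, [c * |A| <= |F A|] with [c > 0], and so are all [G] close to
    [F], with the constant [c / 2]; in particular they are invertible.

    Existence: by the parallelogram law, two almost optimal feasible points have
    images under [F], hence are themselves, close to each other. A minimising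
    sequence is therefore Cauchy; it converges since convergence can be checked
    on entries, and its limit is feasible because the cone is closed
    ([minimiser_exists]).

    Uniqueness and continuity: a minimiser satisfies the variational inequality
    [0 <= <F B - Y, F (C - B)>] for all feasible [C]. Testing the minimiser of
    each of two problems [(F, Y)] and [(G, Z)] against that of the other and
    adding the two inequalities bounds the distance of the minimisers linearly
    in [|F - G|] and [|Y - Z|] ([minimiser_lipschitz]). Uniqueness is the case
    of equal data, and [Bstar] is locally Lipschitz.

    Differentiability: with [B], [C] the minimisers for [F], [G] and
    [H = G - F], optimality gives
    [objective G C - objective F C <= objective G C - objective F B
      <= objective G B - objective F B].
    The outer terms are explicit quadratic polynomials in [H] with linear parts
    [2 <F C - Y, H C>] and [2 <F B - Y, H B>], which differ by a quantity of
    second order because [|C - B|] is of order [|H|]. So [V] has derivative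
    [gradV F Y H = <F B - Y, H B>], with a quadratic remainder
    ([V_expansion]); the same Lipschitz bound makes [gradV] locally Lipschitz
    in [F] ([gradV_lipschitz]). The claims on [T] follow since [T] is a constant
    minus [2 V]. *)

(** * The Frobenius inner product *)

Section InnerProduct.
Variables (R : realType) (k : nat).
Implicit Types (A B C : symmx R k) (a : R).

Lemma innerDr A B C : inner A (B + C) = inner A B + inner A C.
Proof. by rewrite innerC innerDl !(innerC _ A). Qed.

Lemma innerZr a A B : inner A (a *: B) = a * inner A B.
Proof. by rewrite innerC innerZl innerC. Qed.

Lemma innerNl A B : inner (- A) B = - inner A B.
Proof. by rewrite -scaleN1r innerZl mulN1r. Qed.

Lemma innerNr A B : inner A (- B) = - inner A B.
Proof. by rewrite innerC innerNl innerC. Qed.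

Lemma normE2 A : `|A| ^+ 2 = inner A A.
Proof. by rewrite symmx_normE sqr_sqrtr // inner_ge0. Qed.

Lemma norm_inner A B : `|inner A B| <= `|A| * `|B|.
Proof.
rewrite -(@ler_pXn2r _ 2) ?nnegrE ?mulr_ge0 //.
rewrite exprMn !normE2 real_normK ?num_real //.
exact: inner_CauchySchwarz.
Qed.

Lemma sqnormD A B : `|A + B| ^+ 2 = `|A| ^+ 2 + 2 * inner A B + `|B| ^+ 2.
Proof. rewrite !normE2 !(innerDl, innerDr) (innerC B A); ring. Qed.

(** The parallelogram law, solved for the difference: it measures how strictly
    convex the squared norm is at a midpoint. *)
Lemma sqnorm_midpoint A B : `|A - B| ^+ 2 =
  2 * `|A| ^+ 2 + 2 * `|B| ^+ 2 - 4 * `|2^-1 *: (A + B)| ^+ 2.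
Proof.
rewrite !normE2 !(innerDl, innerDr, innerZl, innerZr, innerNl, innerNr).
by rewrite (innerC B A); move: (inner _ _) (inner A B) (inner _ _) => a b c; field.
Qed.

End InnerProduct.

(** * Completeness and continuity on symmetric matrices *)

Section Topology.
Variables (R : realType) (k : nat).

(** The norm topology is complete because each entry is a 1-Lipschitz function,
    so entries form real Cauchy filters, and a symmetric matrix is a finite
    linear combination of fixed matrices with its entries as coefficients. *)
Lemma symmx_cauchy_cvg (F : set_system (symmx R k)) :
  ProperFilter F -> cauchy F -> cvg F.
Proof.
move=> FF /cauchy_ballP Fc.
have entry_cvg i j : cvg ((fun A : symmx R k => vsval A i j) @ F).
  apply: cauchy_cvg; apply/cauchy_ballP => e e0; near_simpl.
  have := Fc e e0; apply: filterS => -[A B] /=.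
  rewrite -!ball_normE /= => /(le_lt_trans _); apply.
  by have := entry_le_norm (A - B) i j; rewrite linearB !mxE.
(* Elementary matrices need not be symmetric; their symmetric projections
   span, with the entries of the symmetric matrix as coefficients. *)
pose E i j := vsproj (symspace R k) (delta_mx i j) : symmx R k.
pose l i j := lim ((fun A : symmx R k => vsval A i j) @ F).
apply/cvg_ex; exists (\sum_i \sum_j l i j *: E i j).
rewrite -[F]/(id @ F).
have -> : id = (fun A : symmx R k => \sum_i \sum_j vsval A i j *: E i j).
  apply/funext => A; rewrite -[LHS](vsvalK A).
  rewrite {1}(matrix_sum_delta (vsval A)) linear_sum; apply: eq_bigr => i _.
  by rewrite linear_sum; apply: eq_bigr => j _; rewrite linearZ.
apply: cvg_big => [|i _]; first exact: (@add_continuous (symmx R k)).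
apply: cvg_big => [|j _]; first exact: (@add_continuous (symmx R k)).
by apply: cvgZr_tmp; exact: entry_cvg.
Unshelve. all: by end_near. Qed.

Lemma norm_symop (F : symop R k) A : `|F A| <= `|F| * `|A|.
Proof. exact: le_opnorm. Qed.

Lemma symop_continuous (F : symop R k) : continuous (F : symmx R k -> symmx R k).
Proof.
apply: bounded_linear_continuous; apply/linear_boundedP.
exists `|F|; split; first exact: num_real.
move=> r Fr A; apply: le_trans (norm_symop F A) _.
by rewrite ler_wpM2r // ltW.
Qed.

Lemma inner_continuous (A : symmx R k) : continuous (fun B => inner B A).
Proof.
move=> B; apply/(@cvgrPdist_lt _ _ _ (nbhs B)) => e e0; near=> C.
have -> : inner B A - inner C A = inner (B - C) A by rewrite innerDl innerNl.
apply: le_lt_trans (norm_inner _ _) _.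
apply: le_lt_trans (_ : _ <= `|B - C| * (`|A| + 1)) _.
  by rewrite ler_wpM2l // lerDl.
rewrite -ltr_pdivlMr ?ltr_wpDl //; near: C.
by apply: cvgr_dist_lt => //; rewrite divr_gt0 ?ltr_wpDl.
Unshelve. all: by end_near. Qed.

End Topology.

(** * The positive semidefinite cone *)

Section Cone.
Variables (R : realType) (k : nat).
Implicit Types A B C : symmx R k.

Lemma psd0 : psd (0 : symmx R k).
Proof.
move=> x; have -> : vsval (0 : symmx R k) = 0 by exact: linear0.
by rewrite mulmx0 mul0mx mxE.
Qed.

Lemma psd_comb (a b : R) A B :
  0 <= a -> 0 <= b -> psd A -> psd B -> psd (a *: A + b *: B).
Proof.
move=> a0 b0 pA pB x.
have -> : vsval (a *: A + b *: B) = a *: vsval A + b *: vsval B.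
  by rewrite linearD !linearZ.
rewrite mulmxDr mulmxDl.
by rewrite -!scalemxAr -!scalemxAl mxE addr_ge0 // mxE mulr_ge0.
Qed.

(** Since [x^T B x = <B, x x^T>], the cone is an intersection of closed
    half-spaces. *)
Lemma psd_closed : closed (@psd R k).
Proof.
have -> : @psd R k = \bigcap_(x : 'cV[R]_k)
    ((fun B => inner B (vsproj (symspace R k) (x *m x^T))) @^-1` [set y | 0 <= y]).
  apply/seteqP; split => B /= pB x.
    move=> _ /=; rewrite /inner vsprojK; last first.
      by apply/symspaceP; rewrite trmx_mul trmxK.
    by rewrite mulmxA mxtrace_mulC mulmxA /mxtrace big_ord1.
  have /= := pB x I; rewrite /inner vsprojK; last first.
    by apply/symspaceP; rewrite trmx_mul trmxK.
  by rewrite mulmxA mxtrace_mulC mulmxA /mxtrace big_ord1.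
apply: (@closed_bigI (symmx R k)) => x _.
apply: (@preimage_closed (symmx R k)); last exact: closed_ge.
by move=> B _; exact: inner_continuous.
Qed.

End Cone.

(** * Operators bounded below *)

Section Coercivity.
Variables (R : realType) (k : nat).
Implicit Types (F G : symop R k) (A : symmx R k) (c : R).

Lemma symopD F G A : (F + G) A = F A + G A.
Proof. exact: add_lfunE. Qed.

Lemma symopB F G A : (F - G) A = F A - G A.
Proof. by rewrite symopD; congr (_ + _); exact: opp_lfunE. Qed.

(** Invertibility in a form that survives small perturbations with an explicit
    constant. *)
Definition bounded_below c F := forall A, c * `|A| <= `|F A|.

Lemma bijective_bounded_below F :
  bijective F -> exists2 c, 0 < c & bounded_below c F.
Proof.
move=> /bij_inj Finj; have kerF : lker F == 0%VS by apply/lker0P.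
pose G : symop R k := (F^-1)%VF.
exists (`|G| + 1)^-1; first by rewrite invr_gt0 ltr_wpDl.
move=> A; rewrite ler_pdivrMl ?ltr_wpDl //.
rewrite -{1}(lker0_lfunK kerF A) -/G.
apply: le_trans (norm_symop G _) _.
by rewrite ler_wpM2r // lerDl.
Qed.

Lemma bounded_below_bijective c F : 0 < c -> bounded_below c F -> bijective F.
Proof.
move=> c0 Fc; have kerF : lker F == 0%VS.
  apply/lker0P => A B FAB; apply/subr0_eq/eqP; rewrite -normr_le0.
  by rewrite -(pmulr_rle0 _ c0) (le_trans (Fc _)) // linearB /= FAB subrr normr0.
by exists (F^-1)%VF; [exact: lker0_lfunK|exact: lker0_lfunVK].
Qed.

Lemma bounded_below_near c F G :
  bounded_below c F -> `|G - F| <= c / 2 -> bounded_below (c / 2) G.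
Proof.
move=> Fc GF A; have := Fc A.
have := norm_symop (G - F) A; rewrite symopB distrC.
have := ler_normD (F A - G A) (G A); rewrite subrK.
have : `|G - F| * `|A| <= c / 2 * `|A| by rewrite ler_wpM2r.
set x := _ * `|A|; set y := `|_ - G A|; rewrite -/x; lra.
Qed.

End Coercivity.

(** * Minimisers: existence, variational inequality, stability *)

Section Minimiser.
Variables (R : realType) (k : nat).
Implicit Types (F G : symop R k) (Y Z B C : symmx R k) (c : R).

Lemma objective_midpoint F Y B C : `|F (B - C)| ^+ 2 =
  2 * objective F Y B + 2 * objective F Y C
  - 4 * objective F Y (2^-1 *: B + 2^-1 *: C).
Proof.
have -> : F (B - C) = (F B - Y) - (F C - Y).
  by rewrite opprB addrA subrK (linearB F).
rewrite sqnorm_midpoint /objective.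
have -> // : 2^-1 *: (F B - Y + (F C - Y)) = F (2^-1 *: B + 2^-1 *: C) - Y.
rewrite (linearD F) !linearZ /= addrACA scalerDr -opprD -mulr2n -(scaler_nat 2 Y).
by rewrite scalerN scalerA mulVf // scale1r scalerDr.
Qed.

(** By the midpoint identity the points of a minimising sequence are close to
    each other, as their midpoints are feasible and cannot fall below the
    infimum. *)
Lemma minimiser_exists c F Y :
  0 < c -> bounded_below c F -> exists B, minimiser F Y B.
Proof.
move=> c0 Fc; pose E := [set objective F Y B | B in @psd R k]; pose m := inf E.
have E0 : E !=set0 by exists (objective F Y 0), 0 => //; exact: psd0.
have Elb : has_lbound E by exists 0 => _ [B _ <-]; rewrite /objective sqr_ge0.
have m_le B : psd B -> m <= objective F Y B.
  by move=> pB; apply: ge_inf => //; exists B.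
have approx n : exists B, psd B /\ objective F Y B < m + n.+1%:R^-1.
  have [|_ [B pB <-] Bm] := @inf_lt _ _ (m + n.+1%:R^-1) E0; last by exists B.
  by rewrite ltrDl invr_gt0 ltr0n.
have [u up] := choice approx; have up1 n := (up n).1; have up2 n := (up n).2.
have gap n p : (c * `|u n - u p|) ^+ 2 <= 2 * (n.+1%:R^-1 + p.+1%:R^-1).
  apply: le_trans (_ : `|F (u n - u p)| ^+ 2 <= _).
    by rewrite ler_pXn2r ?nnegrE // mulr_ge0 // ltW.
  rewrite (objective_midpoint F Y).
  have gapR (a b t x y : R) : a < m + x -> b < m + y -> m <= t ->
    2 * a + 2 * b - 4 * t <= 2 * (x + y) by lra.
  apply: gapR (up2 n) (up2 p) (m_le _ (psd_comb _ _ (up1 n) (up1 p))).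
    by rewrite invr_ge0.
  by rewrite invr_ge0.
have uc : cauchy (u @ \oo).
  apply: cauchy_exP => e e0.
  have ce0 : 0 < (c * e) ^+ 2 / 4 by rewrite divr_gt0 // exprn_gt0 ?mulr_gt0.
  have [N _ NP] := near_infty_natSinv_lt (PosNum ce0).
  exists (u N), N => // n Nn /=; rewrite -ball_normE /= -(ltr_pM2l c0).
  rewrite -(@ltr_pXn2r _ 2) ?nnegrE ?mulr_ge0 ?(ltW c0) ?(ltW e0) //.
  apply: le_lt_trans (gap _ _) _.
  have := NP N (leqnn N); have := NP n Nn; rewrite /=.
  move: (N.+1%:R^-1) (n.+1%:R^-1) (_ ^+ 2) => x y z; lra.
have /cvg_ex[B uB] : cvg (u @ \oo) by exact: symmx_cauchy_cvg.
exists B; split.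
  by apply: (closed_cvg _ (@psd_closed R k) _ _ uB); exact: nearW.
move=> C /m_le; apply: le_trans; apply/ler_addgt0Pr => e e0.
have [N _ NP] := near_infty_natSinv_lt (PosNum e0).
have oB : objective F Y (u n) @[n --> \oo] --> objective F Y B.
  have FB : F (u n) - Y @[n --> \oo] --> F B - Y.
    apply: cvgB; last exact: cvg_cst.
    by apply: continuous_cvg => //; exact: symop_continuous.
  have nB : `|F (u n) - Y| @[n --> \oo] --> `|F B - Y| by exact: cvg_norm.
  by apply: (cvg_comp _ (fun x : R => x ^+ 2) nB); exact: exprn_continuous.
rewrite -(cvg_lim _ oB) //; apply: limr_le.
  by apply/cvg_ex; exists (objective F Y B).
exists N => // n Nn /=; apply/ltW/(lt_trans (up2 n)).
by rewrite ltrD2l NP.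
Qed.

Lemma objective_shift F Y B C : objective F Y C =
  objective F Y B + 2 * inner (F B - Y) (F (C - B)) + `|F (C - B)| ^+ 2.
Proof.
rewrite /objective -sqnormD (linearB F) /=; congr (`|_| ^+ 2).
by rewrite [RHS]addrC addrA subrK.
Qed.

(** First-order optimality: were the slope [p] towards [C] negative, a short
    step along the segment, which stays in the cone, would lower the
    objective. *)
Lemma minimiser_variational F Y B C :
  minimiser F Y B -> psd C -> 0 <= inner (F B - Y) (F (C - B)).
Proof.
move=> [pB Bmin] pC; set p := inner _ _; set q := `|F (C - B)| ^+ 2.
have q0 : 0 <= q by exact: sqr_ge0.
rewrite leNgt; apply/negP => p0.
(* This step satisfies [t <= 1] and makes [2 * p + t * q] equal to
   [p + t * p], which is negative. *)
pose t := - p / (q - p).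
have qp : 0 < q - p by lra.
have t0 : 0 < t by rewrite divr_gt0 // oppr_gt0.
have t1 : t <= 1 by rewrite ler_pdivrMr // mul1r; lra.
have tqp : t * (q - p) = - p by rewrite divfK // gt_eqF.
have pt : psd (B + t *: (C - B)).
  rewrite (_ : _ + _ = (1 - t) *: B + t *: C); last first.
    by rewrite scalerBl scale1r scalerBr addrA addrAC.
  by apply: psd_comb => //; [rewrite subr_ge0|exact: ltW].
have := Bmin _ pt; rewrite (objective_shift F Y B (B + t *: _)) [B + _]addrC addrK.
rewrite linearZ /= innerZr normrZ exprMn (ger0_norm (ltW t0)) -/p -/q -addrA lerDl.
rewrite leNgt => /negP; apply.
rewrite (_ : _ + _ = t * (2 * p + t * q)); last by ring.
by rewrite pmulr_rlt0 //; have : 0 < t * - p; [rewrite mulr_gt0 ?oppr_gt0|]; lra.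
Qed.

(** With [D = C - B], the variational inequalities at [B] and [C] add up to
    [|G D|^2 <= <F B - Y, F D> - <G B - Z, G D>], whose right-hand side vanishes
    when the data agree. One factor [|G D|] can be divided out, so the
    dependence on the data is Lipschitz. The bound contains [|B|] but not
    [|C|], so it controls [C] when the data [(G, Z)] vary. *)
Lemma minimiser_lipschitz c F G Y Z B C :
  0 < c -> bounded_below c G -> minimiser F Y B -> minimiser G Z C ->
  c ^+ 2 * `|C - B| <=
    `|F B - Y| * `|F - G| + c * (`|F - G| * `|B| + `|Y - Z|).
Proof.
move=> c0 Gc mB mC.
have := minimiser_variational mB mC.1; have := minimiser_variational mC mB.1.
rewrite -[B - C]opprB linearN innerNr oppr_ge0; set D := C - B => GD FD.
have GC : G C - Z = (G B - Z) + G D.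
  by rewrite /D (linearB G) /= [RHS]addrC addrA subrK.
have le1 : `|G D| ^+ 2 <=
    inner (F B - Y) ((F - G) D) + inner ((F - G) B - (Y - Z)) (G D).
  rewrite normE2 !symopB.
  move: GD FD; rewrite GC !(innerDl, innerDr, innerNl, innerNr); lra.
set e := `|F - G|; set p := `|F B - Y|; set q := e * `|B| + `|Y - Z|.
have [e0 p0] : 0 <= e /\ 0 <= p by split; exact: normr_ge0.
have q0 : 0 <= q by rewrite addr_ge0 ?mulr_ge0.
have le2 : `|G D| ^+ 2 <= p * (e * `|D|) + q * `|G D|.
  apply: le_trans le1 _; apply: lerD; apply: le_trans (ler_norm _) _.
    by apply: le_trans (norm_inner _ _) _; rewrite ler_wpM2l // norm_symop.
  apply: le_trans (norm_inner _ _) _; rewrite ler_wpM2r //.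
  by apply: le_trans (ler_normB _ _) _; rewrite lerD2r norm_symop.
have cD := Gc D; have [->|D0] := eqVneq D 0.
  by rewrite normr0 mulr0 addr_ge0 // mulr_ge0 // ltW.
(* Multiply by [c] and replace [c * |D|] with the larger [|G D|]; every term
   then contains the positive factor [|G D|]. *)
have GD0 : 0 < `|G D| by apply: lt_le_trans cD; rewrite mulr_gt0 // normr_gt0.
have : c * `|G D| <= p * e + c * q.
  rewrite -(ler_pM2r GD0) -mulrA -expr2.
  apply: le_trans (ler_wpM2l (ltW c0) le2) _.
  have : p * e * (c * `|D|) <= p * e * `|G D| by rewrite ler_wpM2l // mulr_ge0.
  move: (`|D|) (`|G D|) => x y; lra.
by apply: le_trans; rewrite expr2 -mulrA ler_wpM2l // ltW.
Qed.

Lemma minimiser_unique F Y B C :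
  bijective F -> minimiser F Y B -> minimiser F Y C -> B = C.
Proof.
move=> /bijective_bounded_below[c c0 Fc] mB mC; apply/esym/subr0_eq/eqP.
have := minimiser_lipschitz c0 Fc mB mC.
rewrite !subrr !normr0 mulr0 mul0r addr0 mulr0 addr0.
by rewrite pmulr_rle0 ?exprn_gt0 // normr_le0.
Qed.

Lemma Bstar_minimiser F Y : bijective F -> minimiser F Y (Bstar F Y).
Proof.
move=> /bijective_bounded_below[c c0 Fc].
by have [B mB] := minimiser_exists Y c0 Fc; apply: getPex; exists B.
Qed.

Lemma V_Bstar F Y : bijective F -> V F Y = 2^-1 * objective F Y (Bstar F Y).
Proof.
move=> /(Bstar_minimiser Y)[pB Bmin]; congr (_ * _); apply/eqP.
rewrite eq_le; apply/andP; split.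
  apply: ge_inf; last by exists (Bstar F Y).
  by exists (objective F Y (Bstar F Y)) => _ [C pC <-]; exact: Bmin.
apply: lb_le_inf; first by exists (objective F Y (Bstar F Y)), (Bstar F Y).
by move=> _ [C pC <-]; exact: Bmin.
Qed.

(** The radius is at most 1 so that [K * |G - F|] is at most [K], which
    bounds [|Bstar G Y|] uniformly in the estimates of second order. *)
Lemma Bstar_locally_lipschitz F Y : bijective F ->
  exists r K : R, [/\ 0 < r <= 1, 0 <= K & forall G Z, `|G - F| <= r ->
    bijective G /\ `|Bstar G Z - Bstar F Y| <= K * (`|G - F| + `|Z - Y|)].
Proof.
move=> bF; have [c c0 Fc] := bijective_bounded_below bF.
have d0 : 0 < c / 2 by rewrite divr_gt0.
set d := c / 2 in d0; set B := Bstar F Y; set p := `|F B - Y|.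
have p0 : 0 <= p by exact: normr_ge0.
exists (Num.min d 1), ((p + d * `|B| + d) / d ^+ 2).
have pB0 : 0 <= p + d * `|B|.
  exact: addr_ge0 p0 (mulr_ge0 (ltW d0) (normr_ge0 _)).
have n0 : 0 <= p + d * `|B| + d by exact: addr_ge0 pB0 (ltW d0).
split; first by rewrite lt_min d0 ltr01 ge_min lexx orbT.
  by rewrite divr_ge0 // exprn_ge0 // ltW.
move=> G Z; rewrite le_min => /andP[GF _].
have Gd := bounded_below_near Fc GF.
have bG := bounded_below_bijective d0 Gd; split=> //.
rewrite mulrAC ler_pdivlMr ?exprn_gt0 // mulrC.
apply: le_trans (minimiser_lipschitz d0 Gd (Bstar_minimiser Y bF)
  (Bstar_minimiser Z bG)) _.
rewrite -/B -/p (distrC F) (distrC Y).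
have : 0 <= d * `|G - F| by rewrite mulr_ge0 // ltW.
have : 0 <= (p + d * `|B|) * `|Z - Y| by exact: mulr_ge0 pB0 (normr_ge0 _).
move: `|B| `|G - F| `|Z - Y| => x y z; lra.
Qed.

End Minimiser.

(** * Differentiability criteria *)

Section Calculus.
Variables (R : realType) (U W : normedModType R).

Lemma is_diff_quadratic (f : U -> W) (L : {linear U -> W}) x (r C : R) :
  continuous L -> 0 < r ->
  (forall y, `|y - x| <= r -> `|f y - f x - L (y - x)| <= C * `|y - x| ^+ 2) ->
  is_diff x f L.
Proof.
move=> cL r0 fC.
have dL : f \o shift x = cst (f x) + L +o_ 0 id.
  apply/eqaddoP => e e0; near=> h.
  rewrite /= (_ : (_ - _) h = f (h + x) - f x - L h); last first.
    by rewrite !fctE /= opprD addrA.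
  have := fC (h + x); rewrite addrK => fCh.
  apply: le_trans (fCh _) _; first by near: h; exact: nbhs0_le.
  rewrite expr2 mulrA ler_wpM2r //.
  apply: le_trans (_ : (`|C| + 1) * `|h| <= _).
    by rewrite ler_wpM2r // (le_trans (ler_norm _)) // lerDl.
  rewrite mulrC -ler_pdivlMr ?ltr_wpDl //; near: h.
  by apply: nbhs0_le; rewrite divr_gt0 // ltr_wpDl.
have dE := diff_unique cL dL.
by apply: DiffDef (dE); apply/diff_locallyP; rewrite dE.
Unshelve. all: by end_near. Qed.

(** A derivative that is locally Lipschitz for the operator norm is continuous. *)
Lemma continuously_differentiable_onP (D : set U) (f : U -> W) (g : U -> U -> W) :
  (forall x, D x -> is_diff x f (g x)) ->
  (forall x, D x -> exists r C : R, 0 < r /\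
     forall y, D y -> `|y - x| <= r ->
       forall h, `|g y h - g x h| <= C * `|y - x| * `|h|) ->
  continuously_differentiable_on D f.
Proof.
move=> df gC; split=> [x /df[]//|x Dx e e0].
have [r [C [r0 xC]]] := gC x Dx.
have C0 : 0 < `|C| + 1 by rewrite ltr_wpDl.
rewrite near_withinE; near=> y => Dy h.
rewrite (@diff_val _ _ _ _ _ _ _ (df x Dx)) (@diff_val _ _ _ _ _ _ _ (df y Dy)).
have yx : `|y - x| <= Num.min r (e / (`|C| + 1)).
  rewrite distrC; near: y; apply: (@cvgr_dist_le _ _ _ (nbhs x)) => //.
  by rewrite lt_min r0 divr_gt0.
move: yx; rewrite le_min => /andP[yr ye].
apply: le_trans (xC y Dy yr h) _; rewrite ler_wpM2r //.
apply: le_trans (_ : (`|C| + 1) * `|y - x| <= _).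
  by rewrite ler_wpM2r // (le_trans (ler_norm _)) // lerDl.
by rewrite mulrC -ler_pdivlMr.
Unshelve. all: by end_near. Qed.

End Calculus.

(** * The derivative of the value function *)

Section ValueFunction.
Variables (R : realType) (k : nat).
Implicit Types (F G H : symop R k) (Y B C : symmx R k).

(** The derivative of [V] in [F] as if the minimiser did not move: its motion
    contributes only at second order, because it is optimal. *)
Definition gradV F Y (H : symop R k) : R :=
  inner (F (Bstar F Y) - Y) (H (Bstar F Y)).

Lemma gradV_linear F Y : linear (gradV F Y : symop R k -> R).
Proof.
move=> a H G; rewrite /gradV symopD innerDr; congr (_ + _).
by rewrite (_ : (a *: H) _ = a *: H (Bstar F Y)) ?innerZr //; exact: scale_lfunE.
Qed.

HB.instance Definition _ F Y :=
  GRing.isLinear.Build R (symop R k) R *:%R (gradV F Y) (gradV_linear F Y).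

Lemma gradV_continuous F Y : continuous (gradV F Y : symop R k -> R).
Proof.
apply: (@bounded_linear_continuous R (symop R k) R (gradV F Y)).
apply/linear_boundedP.
exists (`|F (Bstar F Y) - Y| * `|Bstar F Y|); split; first exact: num_real.
move=> r Cr H; apply: le_trans (norm_inner _ _) _.
apply: le_trans (ler_wpM2l (normr_ge0 _) (norm_symop H _)) _.
by rewrite mulrCA mulrC ler_wpM2r // ltW.
Qed.

(** The increment [H] is a separate variable, related to [F] and [G] pointwise,
    so that [G - F] can be treated as an atom. *)
Lemma objective_perturb F G H Y B : (forall A, G A = F A + H A) ->
  objective G Y B =
    objective F Y B + 2 * inner (F B - Y) (H B) + `|H B| ^+ 2.
Proof.
by move=> GE; rewrite /objective -sqnormD GE; congr (`|_| ^+ 2); rewrite addrAC.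
Qed.

(** One estimate for two purposes: [G := F] bounds the second-order error of
    [V], and a general [G] bounds the variation of [gradV]. *)
Lemma inner_pairing_lipschitz F G H Y B C (M : R) : `|C| <= M ->
  `|inner (G C - Y) (H C) - inner (F B - Y) (H B)| <=
  ((`|G - F| * M + `|F| * `|C - B|) * M + `|F B - Y| * `|C - B|) * `|H|.
Proof.
move=> CM.
have -> : inner (G C - Y) (H C) - inner (F B - Y) (H B) =
    inner (G C - F B) (H C) + inner (F B - Y) (H (C - B)).
  by rewrite (linearB H) /= !(innerDl, innerDr, innerNl, innerNr); lra.
have GF : `|G C - F B| <= `|G - F| * M + `|F| * `|C - B|.
  have -> : G C - F B = (G - F) C + F (C - B).
    by rewrite symopB (linearB F) /= addrA subrK.
  apply: le_trans (ler_normD _ _) _; apply: lerD; last exact: norm_symop.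
  by apply: le_trans (norm_symop _ _) _; rewrite ler_wpM2l.
rewrite mulrDl; apply: le_trans (ler_normD _ _) _.
apply: lerD; apply: le_trans (norm_inner _ _) _.
  rewrite -mulrA; apply: ler_pM (normr_ge0 _) (normr_ge0 _) GF _.
  by rewrite mulrC; apply: le_trans (norm_symop _ _) _; rewrite ler_wpM2l.
by rewrite -mulrA ler_wpM2l // mulrC; exact: norm_symop.
Qed.

Lemma norm_near B C (K e : R) :
  0 <= K -> e <= 1 -> `|C - B| <= K * e -> `|C| <= `|B| + K.
Proof.
move=> K0 e1 CB; rewrite -{1}[C](subrK B) [_ + B]addrC.
apply: le_trans (ler_normD _ _) _; rewrite lerD2l.
by apply: le_trans CB _; rewrite ler_piMr.
Qed.

(** The two-sided estimate of an optimal value: [o] and [o'] are the objectives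
    of the old problem at the old and the new minimiser, [i] and [i'] the first
    variations there, [x] and [y] the second variations. The second hypothesis
    is optimality of the new minimiser for the new problem, the third is that of
    the old minimiser for the old one. *)
Lemma danskin_bracket (o o' i i' x y a q : R) :
  `|i' - i| <= q -> o' + 2 * i' + y <= o + 2 * i + x -> o <= o' ->
  x <= a -> 0 <= x -> 0 <= y ->
  `|2^-1 * (o' + 2 * i' + y) - 2^-1 * o - i| <= a + q.
Proof. by rewrite !ler_norml => /andP[? ?] *; apply/andP; split; lra. Qed.

(** Optimality of each minimiser for its own problem brackets [V G Y - V F Y]
    between first variations taken at the two minimisers, which are within a
    multiple of [|G - F|] of each other. *)
Lemma V_expansion F Y : bijective F ->
  exists r C : R, 0 < r /\ forall G, `|G - F| <= r ->
    `|V G Y - V F Y - gradV F Y (G - F)| <= C * `|G - F| ^+ 2.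
Proof.
move=> bF; have [r [K [/andP[r0 r1] K0 lip]]] := Bstar_locally_lipschitz Y bF.
have [pB Bmin] := Bstar_minimiser Y bF.
set B := Bstar F Y in pB Bmin lip *.
exists r, (`|B| ^+ 2 + K * (`|F| * (`|B| + K) + `|F B - Y|)); split=> // G Gr.
have [bG] := lip G Y Gr.
have GE A : G A = F A + (G - F) A by rewrite symopB addrC subrK.
rewrite (subrr Y) (@normr0 _ (symmx R k)) addr0 !V_Bstar // /gradV -/B.
move: (G - F) GE Gr => H GE Hr.
have [pC Cmin] := Bstar_minimiser Y bG.
move: (Bstar G Y) pC Cmin => C pC Cmin dK.
have o1 := Cmin _ pB; have o2 := Bmin _ pC.
rewrite (objective_perturb Y B GE) in o1.
rewrite (objective_perturb Y C GE) in o1 *.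
have HB : `|H B| ^+ 2 <= `|B| ^+ 2 * `|H| ^+ 2.
  rewrite -exprMn mulrC; apply: lerXn2r; rewrite ?nnegrE.
  - exact: normr_ge0.
  - exact: mulr_ge0 (normr_ge0 _) (normr_ge0 _).
  - exact: norm_symop.
have HC : 0 <= `|H C| ^+ 2 by exact: sqr_ge0.
have := inner_pairing_lipschitz F F H Y B (norm_near K0 (le_trans Hr r1) dK).
rewrite (subrr F) (@normr0 _ (symop R k)) mul0r add0r.
move=> pair.
set q := `|F| * (`|B| + K) + `|F B - Y|.
have q0 : 0 <= q.
  exact: addr_ge0 (mulr_ge0 (normr_ge0 F) (addr_ge0 (normr_ge0 B) K0)) (normr_ge0 _).
have qE : (`|F| * `|C - B| * (`|B| + K) + `|F B - Y| * `|C - B|) * `|H| <=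
    K * q * `|H| ^+ 2.
  have -> : (`|F| * `|C - B| * (`|B| + K) + `|F B - Y| * `|C - B|) * `|H| =
    `|C - B| * (q * `|H|) by rewrite /q; ring.
  have -> : K * q * `|H| ^+ 2 = K * `|H| * (q * `|H|) by ring.
  exact: (ler_wpM2r (mulr_ge0 q0 (normr_ge0 H)) dK).
rewrite [leRHS]mulrDl.
exact: (danskin_bracket (le_trans pair qE) o1 o2 HB (sqr_ge0 _) HC).
Qed.

Lemma gradV_lipschitz F Y : bijective F ->
  exists r C : R, 0 < r /\ forall G, bijective G -> `|G - F| <= r ->
    forall H, `|gradV G Y H - gradV F Y H| <= C * `|G - F| * `|H|.
Proof.
move=> bF; have [r [K [/andP[r0 r1] K0 lip]]] := Bstar_locally_lipschitz Y bF.
set B := Bstar F Y in lip *; set M := `|B| + K.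
exists r, ((M + `|F| * K) * M + `|F B - Y| * K); split=> // G bG Gr H.
have [_] := lip G Y Gr.
rewrite (subrr Y) (@normr0 _ (symmx R k)) addr0 /gradV -/B => dK.
have M0 : 0 <= M by exact: addr_ge0 (normr_ge0 _) K0.
have CM := norm_near K0 (le_trans Gr r1) dK.
apply: le_trans (inner_pairing_lipschitz F G H Y B CM) _.
rewrite ler_wpM2r //.
rewrite (_ : _ * `|G - F| = (`|G - F| * M + `|F| * (K * `|G - F|)) * M +
  `|F B - Y| * (K * `|G - F|)); last by ring.
apply: lerD; last by rewrite ler_wpM2l.
by rewrite ler_wpM2r // lerD2l ler_wpM2l.
Qed.

Lemma is_diff_V F Y : bijective F ->
  is_diff F (fun G => V G Y) (gradV F Y).
Proof.
move=> /(V_expansion Y)[r [C [r0 rC]]].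
exact: (is_diff_quadratic (@gradV_continuous F Y) r0 rC).
Qed.

Lemma is_diff_T F Y : bijective F ->
  is_diff F (fun G => T G Y) (fun H => - 2 * gradV F Y H).
Proof.
move=> /(is_diff_V Y) dV.
have -> : (fun G => T G Y) = cst (`|Y| ^+ 2 : R) - 2 *: (fun G => V G Y).
  by apply/funext => G.
apply: is_diff_eq; apply/funext => H.
by rewrite !fctE /= sub0r mulNr.
Qed.

End ValueFunction.

Theorem proposition4p1 (R : realType) (k : nat) :
  [/\ forall (F : symop R k) (Y : symmx R k), bijective F ->
        exists! B, minimiser F Y B,
      {within [set p : symop R k * symmx R k | bijective p.1],
        continuous (fun p => Bstar p.1 p.2)},
      forall Y : symmx R k,
        continuously_differentiable_on
          [set F : symop R k | bijective F] (fun F => V F Y),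
      forall Y : symmx R k,
        continuously_differentiable_on
          [set F : symop R k | bijective F] (fun F => T F Y)
    & forall (F : symop R k) (Y : symmx R k) (dF : symop R k), bijective F ->
        'd (fun G => T G Y) F dF
        = - 2 * inner (F (Bstar F Y) - Y) (dF (Bstar F Y))].
Proof.
split.
- move=> F Y bF; exists (Bstar F Y); split; first exact: Bstar_minimiser.
  by move=> B mB; apply: (minimiser_unique bF _ mB); exact: Bstar_minimiser.
- apply/subspace_continuousP => -[F Y] /= bF.
  have [r [K [/andP[r0 _] K0 lip]]] := Bstar_locally_lipschitz Y bF.
  apply/(@cvgrPdist_le _ _ _ (within _ (nbhs (F, Y)))) => e e0.
  rewrite near_withinE.
  (* The distance of the data is at most [q + q] and [K * (q + q) <= e]. *)
  have K1 : 0 < 2 * K + 1 by lra.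
  pose q := e / (2 * K + 1).
  have q0 : 0 < q by rewrite divr_gt0.
  have qE : q * (2 * K + 1) = e by rewrite divfK // gt_eqF.
  have d0 : 0 < Num.min r q by rewrite lt_min r0.
  exists (ball F (Num.min r q), ball Y (Num.min r q)).
    by split; exact: nbhsx_ballx.
  move=> [G Z] /=; rewrite -!ball_normE /= !lt_min.
  rewrite (distrC F) (distrC Y) => -[/andP[Gr Gq] /andP[_ Zq]] _.
  rewrite distrC; apply: le_trans (lip G Z (ltW Gr)).2 _.
  apply: le_trans (_ : K * (q + q) <= _); last by lra.
  by rewrite ler_wpM2l // lerD // ltW.
- move=> Y; apply: continuously_differentiable_onP => F bF.
    exact: is_diff_V.
  exact: gradV_lipschitz.
- move=> Y; apply: continuously_differentiable_onP => F bF.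
    exact: is_diff_T.
  have [r [C [r0 rC]]] := gradV_lipschitz Y bF.
  exists r, (2 * C); split=> // G bG Gr H.
  rewrite -mulrBr normrM normrN normr_nat -!mulrA ler_wpM2l // mulrA.
  exact: rC.
- move=> F Y dF /(is_diff_T Y) dT.
  by rewrite (@diff_val _ _ _ _ _ _ _ dT).
Qed.
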